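(* Let $G$ be a path-bipartite graph of sets $A$ and $B$. Then the following statements are equivalent: (i) $G$ is path-complete, i.e. $\mathcal{B}_{path}(G)=A\times B$. (ii) The bipartite graph $\mathbf{G}(\mathbf{A},\mathbf{B})$ is complete bipartite with parts $\mathbf{A}$ and $\mathbf{B}$.
   Context: Graphs are simple (no loops, no multiple edges), have a nonempty vertex set $V(G)$ and edge set $E(G)$, and may be infinite. $G[S]$ is the subgraph of $G$ induced by $S\subseteq V(G)$. A path is a finite graph $P$ whose (distinct) vertices can be numbered $u_0,\dots,u_k$, $k\ge 1$, so that $E(P)=\{\{u_0,u_1\},\dots,\{u_{k-1},u_k\}\}$; it joins $u_0$ and $u_k$. Let $A,B$ be nonempty disjoint sets. A path $P$ is a be-path of $A$ and $B$ if $V(P)\subseteq A\cup B$ and there is exactly one edge $\{a_0,b_0\}\in E(P)$ meeting both $A$ and $B$. A graph $G$ is a path-bipartite graph of $A$ and $B$ if $A,B\subseteq V(G)$ and $G$ is the union (of vertex sets and of edge sets) of a nonempty set of be-paths of $A$ and $B$. For such $G$, $\mathcal{B}_{path}(G)$ is the set of all $(a,b)\in A\times B$ for which there is a be-path of $A$ and $B$ that is a subgraph of $G$ and joins $a$ and $b$. Let $\mathbf{A}=\{A^i\colon i\in I\}$ be the set of all connected components of $G[A]$ and $\mathbf{B}=\{B^j\colon j\in J\}$ the set of all connected components of $G[B]$. The bipartite graph $\mathbf{G}=\mathbf{G}(\mathbf{A},\mathbf{B})$ with parts $\mathbf{A}$ and $\mathbf{B}$ has vertex set $\mathbf{A}\cup\mathbf{B}$,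 and for $i_1\in I$, $j_1\in J$, $\{A^{i_1},B^{j_1}\}\in E(\mathbf{G})$ iff there are vertices $a_1$ of $A^{i_1}$ and $b_1$ of $B^{j_1}$ with $(a_1,b_1)\in\mathcal{B}_{path}(G)$ (there are no other edges). A bipartite graph with given parts is complete bipartite if every vertex of one part is adjacent to every vertex of the other. *)

(* Defs.v *)
From mathcomp Require Import all_boot.
From mathcomp Require Import boolp classical_sets.
Set Implicit Arguments.
Unset Strict Implicit.
Unset Printing Implicit Defensive.
Local Open Scope classical_set_scope.

(* An edge is the two-element set of its ends.  The record carries no axioms,
   so that Leibniz equality of graphs is equality of vertex and edge sets;
   the axioms are those of [is_graph]. *)
Record graph (T : Type) := Graph { vert : set T; edges : set (set T) }.

Definition is_graph (T : Type) (G : graph T) : Prop :=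
  vert G !=set0 /\
  forall e, edges G e ->
    exists x y, [/\ vert G x, vert G y, x <> y & e = [set x; y]].

Definition subgraph (T : Type) (H G : graph T) : Prop :=
  vert H `<=` vert G /\ edges H `<=` edges G.

(* Intended for S included in vert G. *)
Definition induced (T : Type) (G : graph T) (S : set T) : graph T :=
  Graph S [set e | edges G e /\ e `<=` S].

(* Only the values u 0, ..., u k of the numbering matter. *)
Definition joins (T : Type) (P : graph T) (x y : T) : Prop :=
  exists (k : nat) (u : nat -> T),
    [/\ (1 <= k)%N,
        forall i j, (i <= k)%N -> (j <= k)%N -> u i = u j -> i = j,
        vert P = [set u i | i in [set i | (i <= k)%N]],
        edges P = [set [set u i; u i.+1] | i in [set i | (i < k)%N]] &
        u 0 = x /\ u k = y].

Definition is_path (T : Type) (P : graph T) : Prop :=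
  exists x y, joins P x y.

Definition connected (T : Type) (G : graph T) : Prop :=
  is_graph G /\
  forall x y, vert G x -> vert G y -> x <> y ->
    exists P, subgraph P G /\ joins P x y.

Definition components (T : Type) (G : graph T) : set (graph T) :=
  [set C | [/\ subgraph C G, connected C &
     forall H, subgraph H G -> connected H -> subgraph C H -> H = C]].

Definition be_path (T : Type) (A B : set T) (P : graph T) : Prop :=
  [/\ is_path P, vert P `<=` A `|` B &
      exists! e, [/\ edges P e, e `&` A !=set0 & e `&` B !=set0]].

Definition path_bipartite (T : Type) (A B : set T) (G : graph T) : Prop :=
  [/\ is_graph G, A `<=` vert G, B `<=` vert G &
      exists F : set (graph T),
        [/\ F !=set0, F `<=` be_path A B,
            vert G = \bigcup_(P in F) vert P &
            edges G = \bigcup_(P in F) edges P]].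

Definition Bpath (T : Type) (A B : set T) (G : graph T) : set (T * T) :=
  [set p | [/\ A p.1, B p.2 &
     exists P, [/\ be_path A B P, subgraph P G & joins P p.1 p.2]]].

Definition path_complete (T : Type) (A B : set T) (G : graph T) : Prop :=
  Bpath A B G = A `*` B.

Definition component_graph (T : Type) (A B : set T) (G : graph T) :
    graph (graph T) :=
  Graph (components (induced G A) `|` components (induced G B))
    [set e | exists C D,
       [/\ components (induced G A) C, components (induced G B) D,
           e = [set C; D] &
           exists a b, [/\ vert C a, vert D b & Bpath A B G (a, b)]]].

Definition bipartite (T : Type) (G : graph T) (X Y : set T) : Prop :=
  [/\ is_graph G, X `&` Y = set0, vert G = X `|` Y &
      forall e, edges G e -> e `&` X !=set0 /\ e `&` Y !=set0].

Definition complete_bipartite (T : Type) (G : graph T) (X Y : set T) : Prop :=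
  bipartite G X Y /\ forall x y, X x -> Y y -> edges G [set x; y].

(* Main.v *)
(** A path from [a1] in [A] to [b1] in [B] with a single crossing edge is a walk
inside [A], the crossing edge, and a walk inside [B].  Hence if the components
of [a] in [G[A]] and of [b] in [G[B]] are adjacent, one prepends a walk of
[G[A]] from [a] and appends a walk of [G[B]] to [b]; after shortening the two
sides separately, the concatenation is a path since [A] and [B] are disjoint,
and the crossing edge is still the only one. *)
Require Import Defs.
From mathcomp Require Import all_boot.
From mathcomp Require Import boolp classical_sets.
Local Open Scope classical_set_scope.
Set Implicit Arguments.
Unset Strict Implicit.

Section Walks.
Context {T : eqType}.
Implicit Types (x y z v : T) (s t : seq T) (e A B : set T) (G H P C : graph T).

(** * Walks given by vertex sequences *)

Fixpoint walk_edges x s : set (set T) :=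
  if s is y :: s' then [set [set x; y]] `|` walk_edges y s' else set0.

Definition walk_graph x s : graph T :=
  Graph [set` x :: s] (walk_edges x s).

(** Unlike in [joins], the walk may be empty and may repeat vertices, so that reflexivity and
    transitivity need no case distinction. *)
Definition reach G x y : Prop :=
  exists s, walk_edges x s `<=` edges G /\ last x s = y.

Lemma walk_edges_cat x s t :
  walk_edges x (s ++ t) = walk_edges x s `|` walk_edges (last x s) t.
Proof.
elim: s x => [|y s IHs] x /=; first by rewrite set0U.
by rewrite IHs setUA.
Qed.

Lemma walk_edges_mem x s e v : walk_edges x s e -> e v -> v \in x :: s.
Proof.
elim: s x => [|y s IHs] x //= [->|/IHs es /es vs]; last by rewrite inE vs orbT.
by case=> ->; rewrite !inE eqxx ?orbT.
Qed.

Lemma walk_edges_induced G A x s :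
  walk_edges x s `<=` edges G -> (forall v, v \in x :: s -> A v) ->
  walk_edges x s `<=` edges (induced G A).
Proof.
move=> sG sA e es; split; first exact: sG.
by move=> v ev; apply: sA; apply: walk_edges_mem es ev.
Qed.

(** Recasting a walk as a boolean [path] makes [shortenP] available for removing loops. *)
Lemma walk_edges_path (E : set (set T)) x s :
  walk_edges x s `<=` E <-> path (fun y z => `[< E [set y; z] >]) x s.
Proof.
elim: s x => [|y s IHs] x /=; first by split=> // _ e.
split.
  move=> sE; apply/andP; split; first by apply/asboolP/sE; left.
  by apply/IHs => e es; apply: sE; right.
by case/andP=> /asboolP xyE /IHs sE e [->|/sE].
Qed.

Lemma walk_edges_map_iota (u : nat -> T) k :
  walk_edges (u 0) (map u (iota 1 k)) =
  [set [set u i; u i.+1] | i in [set i | (i < k)%N]].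
Proof.
elim: k => [|k IHk]; first by apply/seteqP; split=> // e [].
have lastE : last (u 0) (map u (iota 1 k)) = u k.
  rewrite last_map (last_nth 0) -[0 :: _]/(iota 0 k.+1).
  by rewrite size_iota nth_iota.
rewrite -[in LHS](addn1 k) iotaD map_cat walk_edges_cat IHk lastE /= setU0 add1n.
apply/seteqP; split=> e.
  case=> [[i /= ik <-]|->]; first by exists i => //=; apply: ltnW.
  by exists k => /=.
case=> i /=; rewrite ltnS leq_eqVlt => /orP[/eqP->|ik] <-; first by right.
by left; exists i.
Qed.

(** Bridge from numberings to duplicate-free sequences. Leibniz equality with a [walk_graph] is
    attainable because the record [graph] carries no proofs. *)
Lemma joinsP P x y :
  joins P x y <->
  exists s, [/\ s != [::], uniq (x :: s), last x s = y & P = walk_graph x s].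
Proof.
split.
  case: P => V E [k [u [k1 uinj /= -> -> [<- <-]]]].
  have E1 : u 0 :: map u (iota 1 k) = map u (iota 0 k.+1) by [].
  exists (map u (iota 1 k)); split.
  - by case: k k1 {uinj E1}.
  - suff : uniq (map u (iota 0 k.+1)) by [].
    rewrite map_inj_in_uniq ?iota_uniq // => i j.
    by rewrite !mem_iota !add0n !ltnS => ik jk; apply: uinj.
  - by rewrite (last_nth (u 0)) -[u 0 :: _]/(map u (iota 0 k.+1)) size_map
      size_iota (nth_map 0) ?size_iota // nth_iota.
  - rewrite /walk_graph walk_edges_map_iota; congr Graph.
    apply/seteqP; split=> v /=.
      by case=> i ik <-; rewrite E1 map_f ?mem_iota.
    by rewrite E1 => /mapP[i]; rewrite mem_iota => ik ->; exists i.
case=> s [s0 sU <- ->].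
(* The default [x] only fills the indices above [size s], which [joins] ignores. *)
pose u := nth x (x :: s).
have sE : s = map u (iota 1 (size s)).
  apply: (@eq_from_nth _ x); first by rewrite size_map size_iota.
  by move=> i si; rewrite (nth_map 0) ?size_iota // nth_iota.
exists (size s), u; split.
- by rewrite lt0n size_eq0.
- by move=> i j si sj /eqP; rewrite nth_uniq // => /eqP.
- apply/seteqP; split=> v.
    move=> vs; exists (index v (x :: s)); last by rewrite /u nth_index.
    by rewrite /= -index_mem in vs.
  by case=> i si <-; apply: mem_nth.
- by rewrite -walk_edges_map_iota -sE.
- by split; rewrite // /u (last_nth x).
Qed.

Lemma edge_vert G x y : is_graph G -> edges G [set x; y] -> vert G x /\ vert G y.
Proof.
move=> [_ gG] /gG[x' [y' [vx vy _ E]]].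
have sub v : [set x; y] v -> vert G v by rewrite E => -[] ->.
by split; apply: sub; [left|right].
Qed.

Lemma walk_vert G x s v :
  is_graph G -> vert G x -> walk_edges x s `<=` edges G ->
  v \in x :: s -> vert G v.
Proof.
move=> gG; elim: s x => [|y s IHs] x vx sG; rewrite in_cons.
  by rewrite orbF => /eqP->.
case/orP=> [/eqP-> //|]; apply: IHs => [|e es]; last by apply: sG; right.
by have [|] := @edge_vert G x y gG; first by apply: sG; left.
Qed.

(** * Reachability as an equivalence relation *)

Lemma reach_uniq G x y : reach G x y ->
  exists s, [/\ walk_edges x s `<=` edges G, last x s = y & uniq (x :: s)].
Proof.
case=> s [/walk_edges_path sG <-].
by case/shortenP: sG => t tG tU _; exists t; split=> //; apply/walk_edges_path.
Qed.

Lemma reach_refl G x : reach G x x.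
Proof. by exists [::]; split=> // e []. Qed.

Lemma reach_trans G y x z : reach G x y -> reach G y z -> reach G x z.
Proof.
move=> [s [sG sy]] [t [tG tz]]; exists (s ++ t); split; last by rewrite last_cat sy.
by rewrite walk_edges_cat sy subUset.
Qed.

Lemma reach_edge G x y : edges G [set x; y] -> reach G x y.
Proof. by move=> xyG; exists [:: y]; split=> // e /= [->|]. Qed.

Lemma reach_sym G x y : reach G x y -> reach G y x.
Proof.
case=> s [sG <-] {y}; elim: s x sG => [|y s IHs] x sG /=; first exact: reach_refl.
apply: (@reach_trans _ y); first by apply: IHs => e es; apply: sG; right.
by apply: reach_edge; rewrite setUC; apply: sG; left.
Qed.

Lemma reach_subgraph H G x y : subgraph H G -> reach H x y -> reach G x y.
Proof. by move=> [_ HG] [s [sH sy]]; exists s; split=> // e /sH/HG. Qed.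

Lemma joins_reach P x y : joins P x y -> reach P x y.
Proof. by case/joinsP=> s [_ _ sy ->]; exists s; split=> // e. Qed.

(** Paths have at least one edge; [x <> y] rules out the empty walk. *)
Lemma reach_joins G x y : is_graph G -> vert G x -> x <> y -> reach G x y ->
  exists P, subgraph P G /\ joins P x y.
Proof.
move=> gG vx xy /reach_uniq[s [sG sy sU]]; exists (walk_graph x s); split.
  by split=> // v; apply: walk_vert.
by apply/joinsP; exists s; split=> //; case: s sy {sG sU}.
Qed.

Lemma connected_reach C x y : connected C -> vert C x -> vert C y -> reach C x y.
Proof.
move=> [_ cC] vx vy; have [->|/eqP xy] := eqVneq x y; first exact: reach_refl.
by have [P [PC /joins_reach Pxy]] := cC _ _ vx vy xy; apply: reach_subgraph Pxy.
Qed.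

(** * Existence of connected components *)

Lemma is_graph_induced G A : is_graph G -> A !=set0 -> is_graph (induced G A).
Proof.
move=> [_ gG] A0; split=> // e [/gG[x [y [_ _ xy ->]]] eA].
by exists x, y; split=> //; apply: eA; [left|right].
Qed.

(** The component is the subgraph induced on the reachability class of [x]. It is maximal because a
    connected subgraph containing it has only vertices reachable from [x]. *)
Lemma exists_component G x : is_graph G -> vert G x ->
  exists C, components G C /\ vert C x.
Proof.
move=> gG vx; pose R := [set y | reach G x y].
have RG : R `<=` vert G by move=> y [s [sG <-]]; apply: walk_vert sG (mem_last x s).
have Rx : R x by apply: reach_refl.
have gC : is_graph (induced G R) by apply: is_graph_induced => //; exists x.
have reachC y : R y -> reach (induced G R) x y.
  (* The walk stays in [R]: each of its vertices ends a prefix that is itself a walk from [x]. *)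
  case=> s [sG <-]; exists s; split=> //; apply: walk_edges_induced => // v vs.
  case/splitPl: s / vs sG => t1 t2 <- sG.
  exists t1; split=> // e et; apply: sG.
  by rewrite walk_edges_cat; left.
exists (induced G R); split=> //; split=> [||H [vHG eHG] cH [CH eCH]].
- by split=> // e [].
- split=> // y z Ry Rz yz; apply: reach_joins => //.
  exact: reach_trans (reach_sym (reachC _ Ry)) (reachC _ Rz).
- have HR : vert H `<=` R.
    move=> y vy; apply: (@reach_subgraph H) => //.
    by apply: connected_reach => //; apply: CH.
  have eHR : edges H `<=` edges (induced G R).
    move=> e eH; split; first exact: eHG.
    have [[_ /(_ _ eH)[y [z [vy vz _ ->]]]] _] := cH.
    by move=> v [->|->]; apply: HR.
  case: H CH eCH {vHG eHG cH} HR eHR => V E /= RV ER VR RE.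
  by rewrite /induced; congr Graph; apply/seteqP; split.
Qed.

(** * Decomposition and composition of be-paths *)

Lemma crossing_split A B x s :
  A x -> B (last x s) -> (forall v, v \in s -> A v \/ B v) -> A `&` B = set0 ->
  exists s1 z s2, [/\ s = s1 ++ z :: s2, forall v, v \in x :: s1 -> A v & B z].
Proof.
move=> Ax Bs sAB AB0; elim: s x Ax Bs sAB => [|y s IHs] x Ax /= Bs sAB.
  by have : (A `&` B) x by []; rewrite AB0.
have [Ay|By] := sAB y (mem_head _ _); last first.
  by exists [::], y, s; split=> // v; rewrite inE => /eqP->.
have [v vs|s1 [z [s2 [-> s1A Bz]]]] := IHs y Ay Bs.
  by apply: sAB; rewrite inE vs orbT.
by exists (y :: s1), z, s2; split=> // v; rewrite inE => /orP[/eqP->|/s1A].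
Qed.

(** Cut at the first vertex [z] in [B]. A return to [A] after [z] would use another crossing edge,
    against uniqueness. *)
Lemma be_path_split A B x s :
  A `&` B = set0 -> A x -> B (last x s) -> uniq (x :: s) ->
  be_path A B (walk_graph x s) ->
  exists s1 z s2, [/\ s = s1 ++ z :: s2, forall v, v \in x :: s1 -> A v &
                      forall v, v \in z :: s2 -> B v].
Proof.
move=> AB0 Ax Bs sU [_ sAB [e0 [_ e0P]]].
have [v vs|s1 [z [s2 [sE s1A Bz]]]] := crossing_split Ax Bs _ AB0.
  by apply: sAB; rewrite /= inE vs orbT.
exists s1, z, s2; split=> // v vs2.
have [//|Av] : B v \/ A v.
  rewrite or_comm; apply: sAB; rewrite sE /= inE mem_cat vs2.
  by rewrite !orbT.
(* A second crossing edge would lie beyond [z], so would not contain [last x s1]. *)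
exfalso; move: vs2; rewrite inE => /orP[/eqP vz|vs2].
  by have : (A `&` B) v by [split=> //; rewrite vz]; rewrite AB0.
have [t1 [t2 s2E]] : exists t1 t2, s2 = rcons t1 v ++ t2.
  by case/splitPr: s2 / vs2 sE => t1 t2 _; exists t1, t2; rewrite cat_rcons.
(* The stretch from [z] to [v] leads from [B] to [A], so the first-crossing lemma applies with the
   two sides exchanged. *)
have [|w ws||r1 [w [r2 [rE r1B Aw]]]] :=
    @crossing_split B A z (rcons t1 v) Bz.
- by rewrite last_rcons.
- rewrite or_comm; apply: sAB; rewrite sE s2E /= !(inE, mem_cat) ws.
  by rewrite !orbT.
- by rewrite setIC.
have cross y y' : A y -> B y' -> walk_edges x s [set y; y'] -> e0 = [set y; y'].
  move=> Ay By' ys; apply: e0P; split=> //; first by exists y; split=> //; left.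
  by exists y'; split=> //; right.
have e1 : e0 = [set last x s1; z].
  apply: cross => //; first by apply: s1A; apply: mem_last.
  by rewrite sE walk_edges_cat; right; left.
have zs : walk_edges z s2 [set w; last z r1].
  by rewrite s2E rE -catA walk_edges_cat /=; right; left; rewrite setUC.
have e2 : e0 = [set w; last z r1].
  apply: cross => //; first by apply: r1B; apply: mem_last.
  by rewrite sE walk_edges_cat; right; right.
have : last x s1 \in z :: s2.
  by apply: (walk_edges_mem zs); rewrite -e2 e1; left.
move: sU; rewrite sE -cat_cons cat_uniq => /and3P[_ /hasPn nh _] /nh.
by rewrite /= mem_last.
Qed.

(** Disjointness of [A] and [B] keeps the two halves from sharing a vertex. An edge of either half
    has both ends on one side, so only the middle edge crosses. *)
Lemma be_path_cat A B x s z t :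
  A `&` B = set0 -> uniq (x :: s) -> uniq (z :: t) ->
  (forall v, v \in x :: s -> A v) -> (forall v, v \in z :: t -> B v) ->
  be_path A B (walk_graph x (s ++ z :: t)) /\
  joins (walk_graph x (s ++ z :: t)) x (last z t).
Proof.
move=> AB0 sU tU sA tB.
have nAB v : A v -> B v -> False.
  by move=> Av Bv; have : (A `&` B) v by []; rewrite AB0.
have J : joins (walk_graph x (s ++ z :: t)) x (last z t).
  apply/joinsP; exists (s ++ z :: t); split=> //.
  - by case: (s).
  - rewrite -cat_cons cat_uniq sU tU andbT; apply/hasPn => v /tB Bv.
    by apply/negP => /sA /nAB; apply.
  - by rewrite last_cat.
split=> //; split; first by exists x, (last z t).
  move=> v /=; rewrite -cat_cons mem_cat.
  by case/orP=> [/sA|/tB]; [left|right].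
exists [set last x s; z]; split.
  split.
  - by rewrite /= walk_edges_cat; right; left.
  - by exists (last x s); split; [left|apply/sA/mem_last].
  - by exists z; split; [right|apply/tB/mem_head].
move=> e /= []; rewrite walk_edges_cat => -[es|[->//|et]] [a [ea Aa]] [b [eb Bb]].
  by case: (nAB b) => //; apply/sA/(walk_edges_mem es).
by case: (nAB a) => //; apply/tB/(walk_edges_mem et).
Qed.

Lemma Bpath_extend A B G a a1 b1 b :
  is_graph G -> A `<=` vert G -> A `&` B = set0 -> A a -> B b ->
  reach (induced G A) a a1 -> Bpath A B G (a1, b1) ->
  reach (induced G B) b1 b -> Bpath A B G (a, b).
Proof.
move=> gG AG AB0 Aa Bb ra [/= Aa1 Bb1 [P [bP PG /joinsP[s [_ sU sb PE]]]]] rb.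
rewrite {}PE in bP PG; rewrite -sb in Bb1 rb.
have [s1 [z [s2 [sE s1A s2B]]]] := be_path_split AB0 Aa1 Bb1 sU bP.
have [_ /= sG] := PG; rewrite sE walk_edges_cat in sG.
(* Go from [a] to [a1], then along the [A]-part of the given be-path up to its crossing edge, and
   remove loops inside [G[A]]. *)
have /reach_uniq[t1 [t1G t1l t1U]] : reach (induced G A) a (last a1 s1).
  apply: reach_trans ra _; exists s1; split=> //.
  by apply: walk_edges_induced => // e es; apply: sG; left.
have /reach_uniq[t2 [t2G t2l t2U]] : reach (induced G B) z b.
  apply: reach_trans rb; rewrite sE last_cat /=; exists s2; split=> //.
  by apply: walk_edges_induced => // e es; apply: sG; right; right.
have gA : is_graph (induced G A) by apply: is_graph_induced => //; exists a.
have gB : is_graph (induced G B) by apply: is_graph_induced => //; exists b.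
have t1A v : v \in a :: t1 -> A v by apply: (walk_vert gA).
have t2B v : v \in z :: t2 -> B v.
  by apply: (walk_vert gB) => //; apply/s2B/mem_head.
have [bt jt] := be_path_cat AB0 t1U t2U t1A t2B.
(* The crossing edge is that of the given be-path, since [t1] ends at [last a1 s1]. *)
have tG : walk_edges a (t1 ++ z :: t2) `<=` edges G.
  rewrite walk_edges_cat t1l => e [/t1G[] //|[->|/t2G[] //]].
  by apply: sG; right; left.
split=> //; exists (walk_graph a (t1 ++ z :: t2)); split=> //; last by rewrite -t2l.
by split=> // v; apply: walk_vert tG => //; apply: AG.
Qed.

(** * The component graph and the equivalence *)

Lemma component_vert G A C : components (induced G A) C ->
  vert C !=set0 /\ vert C `<=` A.
Proof. by move=> [[]] ? _ [[]]. Qed.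

Lemma components_disjoint G A B C D : A `&` B = set0 ->
  components (induced G A) C -> components (induced G B) D -> C <> D.
Proof.
move=> AB0 /component_vert[[x Cx] CA] /component_vert[_ DB] CD.
have : (A `&` B) x by split; [apply: CA|apply: DB; rewrite -CD].
by rewrite AB0.
Qed.

(** An edge is an unordered pair, so its witnesses [C'], [D'] must be matched with [C], [D].
    Disjointness of the two families of components excludes the swapped matching. *)
Lemma component_graph_edge A B G C D : A `&` B = set0 ->
  components (induced G A) C -> components (induced G B) D ->
  edges (component_graph A B G) [set C; D] <->
  exists a b, [/\ vert C a, vert D b & Bpath A B G (a, b)].
Proof.
move=> AB0 cC cD; split=> [|ab]; last by exists C, D.
case=> C' [D' [cC' cD' E ab]].
have [CC'|CD'] : [set C'; D'] C by rewrite -E; left.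
  have [DC'|DD'] : [set C'; D'] D by rewrite -E; right.
    by case: (components_disjoint AB0 cC' cD).
  by rewrite CC' DD'.
by case: (components_disjoint AB0 cC cD').
Qed.

Lemma bipartite_component_graph A B G :
  is_graph G -> A !=set0 -> A `<=` vert G -> A `&` B = set0 ->
  bipartite (component_graph A B G)
    (components (induced G A)) (components (induced G B)).
Proof.
move=> gG [a Aa] AG AB0; split=> //; first split.
(* The component of [a] serves as the vertex that [is_graph] demands. *)
- have gA : is_graph (induced G A) by apply: is_graph_induced => //; exists a.
  by have [C [cC _]] := exists_component gA Aa; exists C; left.
- move=> e [C [D [cC cD -> _]]]; exists C, D; split=> //; [by left|by right|].
  exact: components_disjoint cC cD.
- apply/seteqP; split=> // C [cC cD].
  by case: (components_disjoint AB0 cC cD).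
- move=> e [C [D [cC cD -> _]]].
  by split; [exists C; split=> //; left|exists D; split=> //; right].
Qed.

Lemma path_complete_components A B G :
  A !=set0 -> B !=set0 -> A `&` B = set0 -> path_bipartite A B G ->
  path_complete A B G <->
  complete_bipartite (component_graph A B G)
    (components (induced G A)) (components (induced G B)).
Proof.
move=> A0 B0 AB0 [gG AG BG _]; split=> [pc|[_ cb]].
  split; first exact: bipartite_component_graph.
  move=> C D cC cD; apply/component_graph_edge => //.
  have [[a Ca] CA] := component_vert cC; have [[b Db] DB] := component_vert cD.
  (* Path-completeness lets any vertices of the two nonempty components witness adjacency. *)
  by exists a, b; split=> //; rewrite pc; split; [apply: CA|apply: DB].
apply/seteqP; split=> [p []//|[a b] [/= Aa Bb]].
have gA := is_graph_induced gG A0; have gB := is_graph_induced gG B0.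
have [C [cC Ca]] := exists_component gA Aa.
have [D [cD Db]] := exists_component gB Bb.
have /(component_graph_edge AB0 cC cD)[a1 [b1 [Ca1 Db1 ab1]]] := cb _ _ cC cD.
have [[sC kC _] [sD kD _]] := (cC, cD).
(* Connectedness of [C] and [D] links [a] to [a1] in [G[A]] and [b1] to [b] in [G[B]]. *)
apply: Bpath_extend ab1 _ => //.
  exact: reach_subgraph sC (connected_reach kC Ca Ca1).
exact: reach_subgraph sD (connected_reach kD Db1 Db).
Qed.

End Walks.

Theorem theorem2p7 (T : Type) (A B : set T) (G : graph T)
    (A0 : A !=set0) (B0 : B !=set0) (AB0 : A `&` B = set0)
    (GAB : path_bipartite A B G) :
  path_complete A B G <->
  complete_bipartite (component_graph A B G)
    (components (induced G A)) (components (induced G B)).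
(* [{classic T}] equips the bare type [T] with the classical decidable equality that sequences
   need. *)
Proof. exact: (@path_complete_components {classic T}). Qed.
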